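(* Let $P$ be a finite poset, $w$ a positive integer and $\epsilon>0$. Suppose $P$ is the disjoint union of $\{x\}$, $D$ and $U$, where $D$ is an ideal and $U$ is a filter of $P$; let $A=\max(D)$ and $B=\min(U)$, and suppose $|A|,|B|\le w$. If $\mathbb{P}(a\prec x\prec b)\ge\epsilon$ for all $a\in A$ and $b\in B$, then $\mathbb{P}(A\prec x\prec B)\ge\epsilon^{w^2}$.
   Context: $\prec$ denotes a uniformly random linear extension of $P$ (a linear order on $P$ extending its order). An ideal is $I$ with $y<z\in I\Rightarrow y\in I$; a filter is defined dually. $\max(D)$ and $\min(U)$ are the sets of maximal elements of $D$ and minimal elements of $U$. $A\prec x\prec B$ means $a\prec x\prec b$ for all $a\in A$, $b\in B$.
   Formalization: D and U are assumed nonempty; otherwise the condition on all a in A, b in B is vacuous and the claim fails, e.g. for the antichain {x,u} with D empty, U={u}, w=1, ε=1, where P(x≺u)=1/2. *)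

(* Defs.v *)
From HB Require Import structures.
From mathcomp Require Import all_boot all_order all_algebra.

Set Implicit Arguments.
Unset Strict Implicit.
Unset Printing Implicit Defensive.

Import Order.TTheory GRing.Theory Num.Theory.

Section Poset.
Context {d : Order.disp_t} {P : finPOrderType d}.
Local Open Scope order_scope.

Definition is_ideal (I : {set P}) : Prop :=
  forall y z : P, y < z -> z \in I -> y \in I.

Definition is_filter (F : {set P}) : Prop :=
  forall y z : P, y < z -> y \in F -> z \in F.

Definition max_elts (S : {set P}) : {set P} :=
  [set a in S | [forall y in S, ~~ (a < y)]].

Definition min_elts (S : {set P}) : {set P} :=
  [set b in S | [forall y in S, ~~ (y < b)]].

(* A linear order on P is represented by the graph L of its strict part:
   "y precedes z" is (y, z) \in L. *)
Definition precedes (L : {set P * P}) (y z : P) : bool := (y, z) \in L.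

Definition is_linear_order (L : {set P * P}) : bool :=
  [&& [forall y, ~~ precedes L y y],
      [forall y, forall z, forall t,
         precedes L y z && precedes L z t ==> precedes L y t]
    & [forall y, forall z,
         (y != z) ==> precedes L y z || precedes L z y]].

Definition is_extension (L : {set P * P}) : bool :=
  [forall y : P, forall z : P, (y < z) ==> precedes L y z].

End Poset.

Definition linear_extensions {d : Order.disp_t} (P : finPOrderType d) :
    {set {set P * P}} :=
  [set L : {set P * P} | is_linear_order L && is_extension L].

(* Probability of the event E when L is a uniformly random linear extension
   of P; the denominator is nonzero since every finite poset has a linear
   extension. *)
Definition linext_prob (R : realFieldType) {d : Order.disp_t}
    (P : finPOrderType d) (E : pred {set P * P}) : R :=
  (#|[set L in linear_extensions P | E L]|%:R / #|linear_extensions P|%:R)%R.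

(* Main.v *)
(** By the XYZ inequality of Shepp, applied to [P] with the relations [x < b]
    for [b] in [T] adjoined, the events [S1 < x] and [S2 < x] are positively
    correlated given [x < T]; hence
    [P(S1 < x < T) P(S2 < x < T) <= P(S1 \cup S2 < x < T)], and dually in [T].
    Splitting first [A] and then [B] into singletons bounds [P(A < x < B)] below
    by a product of [#|A| #|B|] probabilities [P(a < x < b)].

    The XYZ inequality for linear orders is the limit [N -> oo] of the same
    inequality for strictly monotone maps [P -> 'I_N], almost all maps being
    injective; for these maps it follows from the four functions theorem of
    Ahlswede and Daykin, in the lattice that compares [- f x] and the
    differences [f y - f x]. *)
Require Import Defs.
From mathcomp Require Import all_boot all_order all_algebra.
From mathcomp Require Import zify.
Import Order.TTheory GRing.Theory Num.Theory.

Set Implicit Arguments.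
Unset Strict Implicit.
Unset Printing Implicit Defensive.

(** * The four functions theorem of Ahlswede and Daykin *)

Lemma four_numbers (a0 a1 b0 b1 c0 c1 d0 d1 : nat) :
  a0 * b0 <= c0 * d0 -> a0 * b1 <= c1 * d0 -> a1 * b0 <= c1 * d0 ->
  a1 * b1 <= c1 * d1 -> (a0 + a1) * (b0 + b1) <= (c0 + c1) * (d0 + d1).
Proof.
move=> h00 h01 h10 h11.
have key : a0 * b1 + a1 * b0 <= c1 * d0 + c0 * d1.
  have hpq : (a0 * b1) * (a1 * b0) <= (c1 * d0) * (c0 * d1).
    rewrite mulnACA [b1 * b0]mulnC mulnACA.
    by rewrite [leqRHS]mulnACA [c1 * c0]mulnC [leqRHS]mulnACA leq_mul.
  move: (a0 * b1) (a1 * b0) (c1 * d0) (c0 * d1) h01 h10 hpq => p q r s hp hq hpq.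
  case: (posnP r) => [r0|r0]; first lia.
  (* Since [p] and [q] are at most [r], [r * (p + q) <= r * r + p * q <= r * (r + s)]; then cancel
     [r]. *)
  rewrite -(leq_pmul2l r0); nia.
rewrite !mulnDl !mulnDr; lia.
Qed.

Lemma big_subsetU1 (X : finType) (z : X) (E : {set X}) (F : {set X} -> nat) :
  z \notin E ->
  \sum_(A : {set X} | A \subset z |: E) F A =
  \sum_(A : {set X} | A \subset E) (F A + F (z |: A)).
Proof.
move=> zE; rewrite big_split /= (bigID (fun A : {set X} => z \notin A)) /=.
congr (_ + _).
  apply: eq_bigl => A; apply/andP/idP => [[sA zA]|sA].
    by rewrite -(setU1K zE) subsetD1 sA.
  by rewrite (subset_trans sA) ?subsetUr //; split=> //; apply: contra zE; apply: (subsetP sA).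
rewrite (reindex_onto (fun A => z |: A) (fun A => A :\ z)) /=; last first.
  by move=> A /andP[_]; rewrite negbK => zA; rewrite setD1K.
apply: eq_bigl => A; rewrite setU11 /= andbT.
apply/andP/idP => [[sA /eqP <-]|sA].
  by rewrite -(setU1K zE) setSD.
by rewrite setUS // setU1K //; apply: contra zE; apply: (subsetP sA).
Qed.

(** By induction on [E]: an element [z] is removed by replacing each function [F] with
    [A |-> F A + F (z |: A)], and [four_numbers] carries the hypothesis over to these sums. *)
Lemma four_functions_powerset (X : finType) (E : {set X})
    (a b c d : {set X} -> nat) :
  (forall A B : {set X}, A \subset E -> B \subset E ->
     a A * b B <= c (A :|: B) * d (A :&: B)) ->
  (\sum_(A : {set X} | A \subset E) a A) * (\sum_(A : {set X} | A \subset E) b A) <=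
  (\sum_(A : {set X} | A \subset E) c A) * (\sum_(A : {set X} | A \subset E) d A).
Proof.
have [n] := ubnP #|E|; elim: n E a b c d => // n IHn E a b c d.
have [->|[z zE]] := set_0Vmem E.
  move=> _ H; rewrite !(big_pred1 set0); try by move=> A /=; rewrite subset0.
  by have := H set0 set0; rewrite setU0 set0I subxx => /(_ isT isT).
rewrite (cardsD1 z) zE add1n ltnS => cE H.
rewrite -(setD1K zE) !big_subsetU1 ?setD11 //.
apply: IHn => // A B sA sB.
have [zA zB] : z \notin A /\ z \notin B.
  by move: sA sB; rewrite !subsetD1 => /andP[_ ->] /andP[_ ->].
have E' (C : {set X}) : C \subset E :\ z -> C \subset z |: E :\ z /\ z |: C \subset z |: E :\ z.
  by move=> sC; rewrite setUS // (subset_trans sC) // subsetUr.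
have [[sA0 sA1] [sB0 sB1]] := (E' _ sA, E' _ sB).
move: H; rewrite -{1 2}(setD1K zE) => H.
have dz (C : {set X}) : z \notin C -> C :&: [set z] = set0.
  by move=> zC; rewrite setIC disjoint_setI0 // disjoints1.
apply: four_numbers.
- exact: H.
- by have := H _ _ sA0 sB1; rewrite setUCA setIUr dz // set0U.
- by have := H _ _ sA1 sB0; rewrite -setUA setIUl [_ :&: B]setIC dz // set0U.
- by have := H _ _ sA1 sB1; rewrite -setUIr -setUUr.
Qed.

(* Embedding the elements in a Boolean lattice spares a distributive lattice structure on [T]. *)
Lemma card_lattice_embedding (T X : finType) (phi : T -> {set X})
    (join meet : T -> T -> T) (A B C D : {set T}) :
  injective phi ->
  (forall f g, phi (join f g) = phi f :|: phi g) ->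
  (forall f g, phi (meet f g) = phi f :&: phi g) ->
  (forall f g, f \in A -> g \in B -> join f g \in C /\ meet f g \in D) ->
  #|A| * #|B| <= #|C| * #|D|.
Proof.
move=> phiI phiU phiM H.
pose ind (S : {set T}) (Y : {set X}) : nat := Y \in phi @: S.
have cE (S : {set T}) : #|S| = \sum_(Y : {set X} | Y \subset setT) ind S Y.
  rewrite -(card_imset S phiI) -sum1_card big_mkcond /=.
  by apply: eq_big => Y; rewrite ?subsetT // /ind; case: (_ \in _).
rewrite !cE; apply: four_functions_powerset => Y Z _ _; rewrite /ind.
have [/imsetP[f fA ->]|//] := boolP (Y \in phi @: A).
have [/imsetP[g gB ->]|//] := boolP (Z \in phi @: B).
by have [jC mD] := H _ _ fA gB; rewrite -phiU -phiM !imset_f.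
Qed.

(** * Shepp's lattice of maps into a chain *)

Section SheppLattice.
Variables (P : finType) (x : P) (N : nat).
Implicit Types (f g : {ffun P -> 'I_N}) (Q S : {set P * P}).

Definition strict_maps Q : {set {ffun P -> 'I_N}} :=
  [set f : {ffun P -> 'I_N} | [forall p in Q, f p.1 < f p.2]].

Lemma strict_mapsP Q f :
  reflect (forall y z, (y, z) \in Q -> f y < f z) (f \in strict_maps Q).
Proof.
rewrite inE; apply: (iffP forall_inP) => [H y z|H [y z]]; first exact: (H (y, z)).
exact: H.
Qed.

(* The join takes the minimum of the values at [x] and the maximum of the
   differences [f y - f x], the meet the opposite. A truncated subtraction in
   the join is harmless: the other argument of [maxn] is then a true value. *)
Lemma shepp_join_subproof f g (y : P) :
  maxn (f y + minn (f x) (g x) - f x) (g y + minn (f x) (g x) - g x) < N.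
Proof. have := ltn_ord (f y); have := ltn_ord (g y); lia. Qed.

Lemma shepp_meet_subproof f g (y : P) :
  minn (f y + maxn (f x) (g x) - f x) (g y + maxn (f x) (g x) - g x) < N.
Proof. have := ltn_ord (f y); have := ltn_ord (g y); lia. Qed.

Definition shepp_join f g : {ffun P -> 'I_N} :=
  [ffun y => Ordinal (shepp_join_subproof f g y)].

Definition shepp_meet f g : {ffun P -> 'I_N} :=
  [ffun y => Ordinal (shepp_meet_subproof f g y)].

(** Unary codes of [N - f x] and of the differences [f y - f x], the latter shifted by [N] to be
    nonnegative. Maxima of these numbers become unions, minima intersections. *)
Definition shepp_code f : {set P * 'I_(N + N) + 'I_N} :=
  [set u : P * 'I_(N + N) + 'I_N |
    match u with
    | inl (y, k) => k + f x < N + f y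
    | inr k => k + f x < N
    end].

Lemma shepp_code_inj : injective shepp_code.
Proof.
move=> f g /setP E.
have fgx : f x = g x :> nat.
  have [fl gl] := (ltn_ord (f x), ltn_ord (g x)).
  case: (ltngtP (f x) (g x)) => // lt.
    (* [rev_ord (f x)] is [N - 1 - f x], the last threshold in the code of [f]; it is missing from
       that of [g]. *)
    by have := E (inr (rev_ord (f x))); rewrite !inE /=; lia.
  by have := E (inr (rev_ord (g x))); rewrite !inE /=; lia.
apply/ffunP => y; apply: val_inj => /=.
have [fl gl] := (ltn_ord (f y), ltn_ord (g y)).
have [flx glx] := (ltn_ord (f x), ltn_ord (g x)).
case: (ltngtP (f y) (g y)) => // lt.
  (* As [f x = g x], this is the first threshold missing from the code of [f] at [y], and the code
     of [g] contains it. *)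
  have k : N + f y - f x < N + N by lia.
  by have := E (inl (y, Ordinal k)); rewrite !inE /=; lia.
have k : N + g y - g x < N + N by lia.
by have := E (inl (y, Ordinal k)); rewrite !inE /=; lia.
Qed.

Lemma shepp_code_join f g :
  shepp_code (shepp_join f g) = shepp_code f :|: shepp_code g.
Proof. by apply/setP => -[[y k]|k]; rewrite !inE !ffunE /=; lia. Qed.

Lemma shepp_code_meet f g :
  shepp_code (shepp_meet f g) = shepp_code f :&: shepp_code g.
Proof.
have [flx glx] := (ltn_ord (f x), ltn_ord (g x)).
by apply/setP => -[[y k]|k]; rewrite !inE !ffunE /=; lia.
Qed.

Lemma shepp_join_lt f g y z : f y < f z -> g y < g z ->
  shepp_join f g y < shepp_join f g z.
Proof. rewrite !ffunE /=; lia. Qed.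

Lemma shepp_meet_lt f g y z : f y < f z -> g y < g z ->
  shepp_meet f g y < shepp_meet f g z.
Proof. rewrite !ffunE /=; lia. Qed.

(** The difference between the values of the meet at [a] and [x] is the smaller of the two given
    differences, so one negative difference suffices. *)
Lemma shepp_meet_below f g a : (f a < f x) || (g a < g x) ->
  shepp_meet f g a < shepp_meet f g x.
Proof. rewrite !ffunE /=; lia. Qed.

Lemma shepp_join_above f g a : (f x < f a) || (g x < g a) ->
  shepp_join f g x < shepp_join f g a.
Proof. rewrite !ffunE /=; lia. Qed.

(** The meet inherits the pairs of both [S1] and [S2], because they all end in [x]; the join keeps
    those of [Q]. *)
Lemma card_strict_maps_below Q S1 S2 :
  (forall y z, (y, z) \in S1 :|: S2 -> z = x) ->
  #|strict_maps (Q :|: S1)| * #|strict_maps (Q :|: S2)| <=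
  #|strict_maps Q| * #|strict_maps (Q :|: (S1 :|: S2))|.
Proof.
move=> Sx; apply: (card_lattice_embedding shepp_code_inj shepp_code_join shepp_code_meet).
move=> f g /strict_mapsP fS /strict_mapsP gS; split; apply/strict_mapsP => y z.
  by move=> yz; apply: shepp_join_lt; [apply: fS | apply: gS]; rewrite inE yz.
rewrite in_setU => /orP[yz|yz].
  by apply: shepp_meet_lt; [apply: fS | apply: gS]; rewrite inE yz.
have zx := Sx _ _ yz; rewrite zx in yz *; apply: shepp_meet_below.
move: yz; rewrite inE => /orP[] yz; apply/orP; [left|right].
  by apply: fS; rewrite inE yz orbT.
by apply: gS; rewrite inE yz orbT.
Qed.

Lemma card_strict_maps_above Q S1 S2 :
  (forall y z, (y, z) \in S1 :|: S2 -> y = x) ->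
  #|strict_maps (Q :|: S1)| * #|strict_maps (Q :|: S2)| <=
  #|strict_maps Q| * #|strict_maps (Q :|: (S1 :|: S2))|.
Proof.
(* For pairs starting at [x] it is the join that inherits both sets, so the factors change
   places. *)
move=> Sx; rewrite [leqRHS]mulnC.
apply: (card_lattice_embedding shepp_code_inj shepp_code_join shepp_code_meet).
move=> f g /strict_mapsP fS /strict_mapsP gS; split; apply/strict_mapsP => y z; last first.
  by move=> yz; apply: shepp_meet_lt; [apply: fS | apply: gS]; rewrite inE yz.
rewrite in_setU => /orP[yz|yz].
  by apply: shepp_join_lt; [apply: fS | apply: gS]; rewrite inE yz.
have yx := Sx _ _ yz; rewrite yx in yz *; apply: shepp_join_above.
move: yz; rewrite inE => /orP[] yz; apply/orP; [left|right].
  by apply: fS; rewrite inE yz orbT.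
by apply: gS; rewrite inE yz orbT.
Qed.

End SheppLattice.

(** * Linear orders counted through strict maps *)

Definition increasing_maps (n N : nat) : {set {ffun 'I_n -> 'I_N}} :=
  [set g : {ffun 'I_n -> 'I_N} | [forall i : 'I_n, forall j : 'I_n, (i < j) ==> (g i < g j)]].

Section LinearOrders.
Context {d : Order.disp_t} {P : finPOrderType d}.
Implicit Types (Q L : {set P * P}).

Lemma linear_orderP L :
  reflect [/\ forall y, (y, y) \notin L,
              forall y z t, (y, z) \in L -> (z, t) \in L -> (y, t) \in L
            & forall y z, y != z -> ((y, z) \in L) || ((z, y) \in L)]
          (is_linear_order L).
Proof.
apply: (iffP and3P) => -[irr tr tot]; split.
- by move=> y; apply: (forallP irr).
- move=> y z t yz zt; have /forallP/(_ z)/forallP/(_ t) := forallP tr y.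
  by rewrite /precedes yz zt.
- by move=> y z yz; have /forallP/(_ z) := forallP tot y; rewrite /precedes yz.
- by apply/forallP => y; apply: irr.
- apply/forallP => y; apply/forallP => z; apply/forallP => t; apply/implyP.
  by move=> /andP[]; apply: tr.
- by apply/forallP => y; apply/forallP => z; apply/implyP; apply: tot.
Qed.

Definition linear_orders_above Q : {set {set P * P}} :=
  [set L : {set P * P} | is_linear_order L && (Q \subset L)].

Definition map_order N (f : {ffun P -> 'I_N}) : {set P * P} :=
  [set p | f p.1 < f p.2].

Lemma map_order_linear N (f : {ffun P -> 'I_N}) :
  injective f -> is_linear_order (map_order f).
Proof.
move=> fI; apply/linear_orderP; split=> [y|y z t|y z yz]; rewrite !inE /= ?ltnn //.
  exact: ltn_trans.
by rewrite -neq_ltn; apply: contra yz => /eqP/val_inj/fI ->.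
Qed.

(** The rank of an element is the number of its predecessors. *)
Lemma linear_order_rank L : is_linear_order L ->
  exists2 rk : P -> 'I_#|P|, bijective rk & forall y z, (rk y < rk z) = ((y, z) \in L).
Proof.
move=> /linear_orderP[irr tr tot].
pose below y : {set P} := [set z | (z, y) \in L].
have rk_lt y : #|below y| < #|P|.
  rewrite -cardsT; apply: proper_card; rewrite properT.
  by apply/negP => /eqP/setP/(_ y); rewrite !inE (negbTE (irr y)).
pose rk y := Ordinal (rk_lt y).
have rk_mono y z : (y, z) \in L -> rk y < rk z.
  move=> yz; apply: proper_card; apply/properP; split.
    by apply/subsetP => t; rewrite !inE => ty; apply: tr yz.
  by exists y; rewrite inE.
have rkE y z : (rk y < rk z) = ((y, z) \in L).
  apply/idP/idP => [yz|]; last exact: rk_mono.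
  have /tot/orP[//|/rk_mono zy] : y != z by apply: contraTneq yz => ->; rewrite ltnn.
  by move: (ltn_trans yz zy); rewrite ltnn.
exists rk => //; apply: inj_card_bij; last by rewrite card_ord.
move=> y z yz; apply/eqP; apply: contraT => /tot.
by rewrite -!rkE yz ltnn.
Qed.

(** Composition with the rank function of [L] matches the two sets; the count is thus the same for
    every [L]. *)
Lemma card_maps_of_order N L : is_linear_order L ->
  #|[set f : {ffun P -> 'I_N} | injectiveb f & map_order f == L]| =
  #|increasing_maps #|P| N|.
Proof.
move=> linL; have [rk [rk' rkK rk'K] rkE] := linear_order_rank linL.
pose h (g : {ffun 'I_#|P| -> 'I_N}) : {ffun P -> 'I_N} := [ffun y => g (rk y)].
have hI : injective h.
  by move=> g g' /ffunP E; apply/ffunP => i; have := E (rk' i); rewrite !ffunE rk'K.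
rewrite -(card_imset _ hI); apply: eq_card => f; rewrite inE.
apply/andP/imsetP => [[_ /eqP fL]|[g gI ->]].
  exists [ffun i => f (rk' i)]; last by apply/ffunP => y; rewrite !ffunE rkK.
  rewrite inE; apply/forallP => i; apply/forallP => j; apply/implyP => ij.
  rewrite !ffunE; have : (rk' i, rk' j) \in L by rewrite -rkE !rk'K.
  by rewrite -fL inE.
have g_mono (i j : 'I_#|P|) : i < j -> g i < g j.
  by move: gI; rewrite inE => /forallP/(_ i)/forallP/(_ j)/implyP.
have gE (i j : 'I_#|P|) : (g i < g j) = (i < j).
  case: (ltngtP i j) => [/g_mono //|/g_mono|/val_inj ->]; last by rewrite ltnn.
  by case: ltngtP.
split.
  apply/injectiveP => y z; rewrite !ffunE => /(congr1 val) /= yz.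
  apply: (can_inj rkK); apply: val_inj => /=.
  by case: (ltngtP (rk y) (rk z)) => //; rewrite -gE yz ltnn.
by apply/eqP/setP => -[y z]; rewrite inE !ffunE gE rkE.
Qed.

Lemma card_injective_strict_maps N Q :
  #|[set f in strict_maps N Q | injectiveb f]| =
  #|linear_orders_above Q| * #|increasing_maps #|P| N|.
Proof.
rewrite -sum1_card (partition_big (@map_order N) (mem (linear_orders_above Q))) /=; last first.
  move=> f; rewrite !inE => /andP[/forall_inP fQ /injectiveP/map_order_linear ->] /=.
  by apply/subsetP => p /fQ; rewrite inE.
rewrite -sum_nat_const; apply: eq_bigr => L; rewrite inE => /andP[linL /subsetP QL].
rewrite -(card_maps_of_order N linL) -sum1_card; apply: eq_bigl => f; rewrite !inE.
case: eqP => [fL|]; rewrite ?andbF // !andbT andbC; case: injectiveb => //=.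
by apply/forall_inP => p /QL; rewrite -fL inE.
Qed.

(** The error term is the number of all non-injective maps [P -> 'I_N]. *)
Lemma card_strict_maps_bounds N Q :
  #|linear_orders_above Q| * #|increasing_maps #|P| N| <= #|strict_maps N Q| <=
  #|linear_orders_above Q| * #|increasing_maps #|P| N| + (N ^ #|P| - N ^_ #|P|).
Proof.
rewrite -card_injective_strict_maps; apply/andP; split.
  by apply: subset_leq_card; apply/subsetP => f; rewrite inE => /andP[].
rewrite -(cardsID [set f : {ffun P -> 'I_N} | injectiveb f]) leq_add //.
  by apply: subset_leq_card; apply/subsetP => f; rewrite !inE.
rewrite (_ : _ - _ = #|~: [set f : {ffun P -> 'I_N} | injectiveb f]|).
  by apply: subset_leq_card; apply/subsetP => f; rewrite !inE => /andP[].
by rewrite cardsCs setCK card_inj_ffuns card_ffun !card_ord.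
Qed.

(** Every injective map induces exactly one linear order. This compares the number of increasing
    maps with the error term. *)
Lemma card_linear_orders_ffact N :
  #|linear_orders_above set0| * #|increasing_maps #|P| N| = N ^_ #|P|.
Proof.
rewrite -card_injective_strict_maps -[N in RHS](card_ord N) -card_inj_ffuns.
apply: eq_card => f; rewrite !inE andb_idl // => _.
by apply/forall_inP => p; rewrite inE.
Qed.

End LinearOrders.

(** * Non-injective maps are negligible *)

Lemma leq_ffact_expn N n : N ^_ n <= N ^ n.
Proof. by elim: n => // n IHn; rewrite ffactnSr expnSr leq_mul // leq_subr. Qed.

Lemma expn_ffact_gap N n : N * N ^ n <= N * N ^_ n + n ^ 2 * N ^ n.
Proof.
elim: n => [|n IHn]; first by rewrite ffactn0 expn0; lia.
rewrite ffactnSr expnSr mulnBr.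
have := leq_ffact_expn N n; move: (N ^ n) (N ^_ n) IHn => X F IHn FX.
have h1 : N * (N * X) <= N * (N * F + n ^ 2 * X) by rewrite leq_mul2l IHn orbT.
have h2 : N * (F * n) <= N * (n * X) by rewrite leq_mul2l [F * n]mulnC leq_mul2l FX !orbT.
nia.
Qed.

Lemma non_injective_negligible n K :
  exists N, n <= N /\ K * (N ^ n - N ^_ n) <= N ^_ n.
Proof.
(* With [E = N ^ n - N ^_ n], the gap bound gives [N * E <= n ^ 2 * N ^ n]; this [N] turns it into
   [K.+1 * E <= N ^ n = E + N ^_ n]. *)
exists (K.+1 * n.+1 ^ 2); split; first by nia.
set N := K.+1 * _.
have := expn_ffact_gap N n; have := leq_ffact_expn N n.
move: (N ^ n) (N ^_ n) => X F /subnKC; move: (X - F) => E <- H.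
suff : n.+1 ^ 2 * (K.+1 * E) <= n.+1 ^ 2 * (E + F) by rewrite leq_pmul2l //; lia.
have h : n ^ 2 * (F + E) <= n.+1 ^ 2 * (F + E) by rewrite leq_mul2r leq_exp2r // leqnSn orbT.
rewrite mulnA [_ * K.+1]mulnC -/N; lia.
Qed.

(** Otherwise [c1 * c2] exceeds [c3 * c4] by at least [1], so [M ^ 2 <= (c3 + c4) * E * M + E ^ 2],
    which the bound on [E] excludes. *)
Lemma leq_of_perturbed (c1 c2 c3 c4 M E : nat) : 0 < M ->
  (c3 + c4 + 2) * E <= M -> (c1 * M) * (c2 * M) <= (c3 * M + E) * (c4 * M + E) ->
  c1 * c2 <= c3 * c4.
Proof.
move=> M0 EM H; rewrite leqNgt; apply/negP => lt.
have h1 : (c3 * c4 + 1) * (M * M) <= (c1 * c2) * (M * M) by rewrite leq_mul2r addn1 lt orbT.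
have h2 : (c3 + c4 + 2) * E * M <= M * M by rewrite leq_mul2r EM orbT.
have h3 : E * E <= E * M by rewrite leq_mul2l; lia.
case: (posnP E) => [E0|E0]; first by rewrite E0 in H; nia.
have h4 : 0 < E * M by rewrite muln_gt0 E0.
nia.
Qed.

(** * The XYZ inequality for linear orders *)

Section XYZ.
Context {d : Order.disp_t} {P : finPOrderType d}.
Implicit Types Q S : {set P * P}.

(** Divided by the number of increasing maps, the counts of strict maps tend to those of linear
    orders. As the latter are integers, one large [N] suffices. *)
Lemma linear_orders_above_correlation Q1 Q2 Q3 Q4 :
  (forall N, #|strict_maps N Q1| * #|strict_maps N Q2| <=
             #|strict_maps N Q3| * #|strict_maps N Q4|) ->
  #|linear_orders_above Q1| * #|linear_orders_above Q2| <=
  #|linear_orders_above Q3| * #|linear_orders_above Q4|.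
Proof.
move=> H; move: (card_strict_maps_bounds ^~ Q1) (card_strict_maps_bounds ^~ Q2).
move: (card_strict_maps_bounds ^~ Q3) (card_strict_maps_bounds ^~ Q4).
move: #|linear_orders_above Q1| #|linear_orders_above Q2| => c1 c2.
move: #|linear_orders_above Q3| #|linear_orders_above Q4| => c3 c4 B3 B4 B1 B2.
pose k := #|@linear_orders_above _ P set0|.
(* The factor [k] is cancelled below against [N ^_ #|P| = k * M]. *)
have [N [nN]] := non_injective_negligible #|P| ((c3 + c4 + 2) * k).
have := card_linear_orders_ffact (P := P) N.
rewrite -/k; set M := #|increasing_maps _ _|; set E := _ - _ => kM.
have kM0 : 0 < k * M by rewrite kM ffact_gt0.
have [k0 M0] : 0 < k /\ 0 < M by move: kM0; rewrite muln_gt0 => /andP.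
rewrite -kM [_ * k]mulnC -mulnA leq_pmul2l // => EM.
apply: leq_of_perturbed M0 EM _.
have [/andP[l1 _] /andP[l2 _]] := (B1 N, B2 N).
have [/andP[_ u3] /andP[_ u4]] := (B3 N, B4 N).
exact: leq_trans (leq_mul l1 l2) (leq_trans (H N) (leq_mul u3 u4)).
Qed.

Lemma xyz_below (x : P) Q S1 S2 :
  (forall y z, (y, z) \in S1 :|: S2 -> z = x) ->
  #|linear_orders_above (Q :|: S1)| * #|linear_orders_above (Q :|: S2)| <=
  #|linear_orders_above Q| * #|linear_orders_above (Q :|: (S1 :|: S2))|.
Proof.
by move=> Sx; apply: linear_orders_above_correlation => N; apply: card_strict_maps_below Sx.
Qed.

Lemma xyz_above (x : P) Q S1 S2 :
  (forall y z, (y, z) \in S1 :|: S2 -> y = x) ->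
  #|linear_orders_above (Q :|: S1)| * #|linear_orders_above (Q :|: S2)| <=
  #|linear_orders_above Q| * #|linear_orders_above (Q :|: (S1 :|: S2))|.
Proof.
by move=> Sx; apply: linear_orders_above_correlation => N; apply: card_strict_maps_above Sx.
Qed.

End XYZ.

(** * Existence of maximal and minimal elements *)

Lemma max_elts_neq0 {d : Order.disp_t} {P : finPOrderType d} (S : {set P}) :
  S != set0 -> max_elts S != set0.
Proof.
have [n] := ubnP #|S|; elim: n S => // n IHn S cS /set0Pn[y yS].
have [noy|] := boolP [forall z in S, ~~ (y < z)%O].
  by apply/set0Pn; exists y; rewrite inE yS.
rewrite negb_forall_in => /exists_inP[z zS]; rewrite negbK => yz.
pose T := [set t in S | (y < t)%O].
have cT : #|T| < n.
  rewrite -ltnS (leq_ltn_trans _ cS) //; apply: proper_card; apply/properP; split.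
    by apply/subsetP => t; rewrite inE => /andP[].
  by exists y; rewrite // inE ltxx andbF.
have T0 : T != set0 by apply/set0Pn; exists z; rewrite inE zS.
have /set0Pn[t] := IHn T cT T0; rewrite !inE => /andP[/andP[tS yt] /forall_inP tmax].
apply/set0Pn; exists t; rewrite inE tS; apply/forall_inP => u uS.
apply/negP => tu; have /tmax : u \in T by rewrite inE uS (lt_trans yt tu).
by rewrite tu.
Qed.

Lemma min_elts_neq0 {d : Order.disp_t} {P : finPOrderType d} (S : {set P}) :
  S != set0 -> min_elts S != set0.
Proof. exact: (@max_elts_neq0 _ P^d). Qed.

(** * Probability that [x] lies between two sets *)

Local Open Scope ring_scope.

(** Elements are split off one at a time down to a singleton, since [p set0] may be less than
    [1]. *)
Lemma expr_card_le_supermultiplicative (R : realFieldType) (I : finType)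
    (p : {set I} -> R) (e : R) (S : {set I}) :
  0 <= e -> S != set0 -> (forall i, i \in S -> e <= p [set i]) ->
  (forall S1 S2, p S1 * p S2 <= p (S1 :|: S2)) -> e ^+ #|S| <= p S.
Proof.
move=> e0 + + pU; have [n] := ubnP #|S|; elim: n S => // n IHn S cS.
case/set0Pn => i iS pi.
have [S'0|S'0] := eqVneq (S :\ i) set0.
  by rewrite -(setD1K iS) S'0 setU0 cards1 expr1 pi.
rewrite (cardsD1 i) iS -{2}(setD1K iS) exprS; apply: le_trans (pU _ _).
apply: ler_pM; rewrite ?exprn_ge0 ?pi // IHn //; first by move: cS; rewrite (cardsD1 i) iS.
by move=> j /setD1P[_ /pi].
Qed.

Section Between.
Context (R : realFieldType) {d : Order.disp_t} {P : finPOrderType d} (x : P).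
Implicit Types S T : {set P}.

Definition between_prob S T : R :=
  linext_prob R (P := P)
    (fun L => [forall a in S, precedes L a x] && [forall b in T, precedes L x b]).

Definition below_pairs S : {set P * P} := [set p | (p.1 \in S) && (p.2 == x)].
Definition above_pairs T : {set P * P} := [set p | (p.1 == x) && (p.2 \in T)].
Definition order_pairs : {set P * P} := [set p | (p.1 < p.2)%O].

Lemma between_probE S T :
  between_prob S T =
  #|linear_orders_above (order_pairs :|: below_pairs S :|: above_pairs T)|%:R /
  #|linear_extensions P|%:R.
Proof.
congr (_%:R / _); apply: eq_card => L; rewrite !inE !subUset -!andbA.
have -> : (order_pairs \subset L) = is_extension L.
  rewrite /is_extension; apply/subsetP/forallP => [H y|H [y z]].
    by apply/forallP => z; apply/implyP => yz; apply: H; rewrite inE.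
  by rewrite inE => /= yz; have /forallP/(_ z)/implyP := H y; apply.
have -> : (below_pairs S \subset L) = [forall a in S, precedes L a x].
  apply/subsetP/forall_inP => [H y yS|H [y z]]; first by apply: H; rewrite inE yS /=.
  by rewrite inE => /= /andP[yS /eqP ->]; apply: H.
have -> // : (above_pairs T \subset L) = [forall b in T, precedes L x b].
apply/subsetP/forall_inP => [H y yS|H [y z]]; first by apply: H; rewrite inE yS /= eqxx.
by rewrite inE => /= /andP[/eqP -> zT]; apply: H.
Qed.

Lemma linear_orders_above_order_pairs Q :
  (#|linear_orders_above (order_pairs :|: Q)| <= #|linear_extensions P|)%N.
Proof.
apply: subset_leq_card; apply/subsetP => L; rewrite !inE subUset => /and3P[-> /subsetP H _] /=.
by apply/forallP => y; apply/forallP => z; apply/implyP => yz; apply: H; rewrite inE.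
Qed.

(** Passes from counts to probabilities, bounding the probability [c3 / n] of the conditioning event
    by [1]. *)
Lemma prob_mul_le (c1 c2 c3 c4 n : nat) : (c1 * c2 <= c3 * c4)%N -> (c3 <= n)%N ->
  (c1%:R / n%:R) * (c2%:R / n%:R) <= c4%:R / n%:R :> R.
Proof.
move=> H c3n; have [->|n0] := posnP n; first by rewrite invr0 !mulr0.
have n0' : 0 < n%:R :> R by rewrite ltr0n.
rewrite mulrACA -invfM ler_pdivrMr ?mulr_gt0 // mulrA divfK ?gt_eqF //.
by rewrite -!natrM ler_nat (leq_trans H) // mulnC leq_mul2l c3n orbT.
Qed.

Lemma between_prob_below S1 S2 T :
  between_prob S1 T * between_prob S2 T <= between_prob (S1 :|: S2) T.
Proof.
rewrite !between_probE.
have -> : below_pairs (S1 :|: S2) = below_pairs S1 :|: below_pairs S2.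
  by apply/setP => p; rewrite !inE andb_orl.
(* The relations placing [x] below [T] join the conditioning set [Q] of the XYZ inequality. *)
rewrite !(setUAC _ _ (above_pairs T)); apply: prob_mul_le (linear_orders_above_order_pairs (above_pairs T)).
apply: (@xyz_below _ _ x) => y z; rewrite !inE /= => /orP[] /andP[_ /eqP //].
Qed.

Lemma between_prob_above S T1 T2 :
  between_prob S T1 * between_prob S T2 <= between_prob S (T1 :|: T2).
Proof.
rewrite !between_probE.
have -> : above_pairs (T1 :|: T2) = above_pairs T1 :|: above_pairs T2.
  by apply/setP => p; rewrite !inE andb_orr.
apply: prob_mul_le (linear_orders_above_order_pairs (below_pairs S)).
apply: (@xyz_above _ _ x) => y z; rewrite !inE /= => /orP[] /andP[/eqP //].
Qed.

Lemma between_prob_le1 S T : between_prob S T <= 1.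
Proof.
rewrite between_probE -setUA.
have [n0|n0] := posnP #|linear_extensions P|; first by rewrite n0 invr0 mulr0.
by rewrite ler_pdivrMr ?ltr0n // mul1r ler_nat linear_orders_above_order_pairs.
Qed.

Lemma between_prob1 a b :
  between_prob [set a] [set b] =
  linext_prob R (P := P) (fun L => precedes L a x && precedes L x b).
Proof.
have allE (p : pred P) c : [forall y in [set c], p y] = p c.
  by apply/forall_inP/idP => [H|pc y /set1P -> //]; apply: H; rewrite inE.
by congr (_%:R / _); apply: eq_card => L; rewrite !inE !allE.
Qed.

End Between.


Theorem theorem2p6 (R : realFieldType) (d : Order.disp_t)
    (P : finPOrderType d) (w : nat) (eps : R) (x : P) (D U : {set P})
    (w_gt0 : (0 < w)%N) (eps_gt0 : 0 < eps)
    (xND : x \notin D) (xNU : x \notin U) (disjDU : [disjoint D & U])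
    (coverP : [set x] :|: D :|: U = [set: P])
    (idealD : is_ideal D) (filterU : is_filter U)
    (D_neq0 : D != set0) (U_neq0 : U != set0)
    (cardA : (#|max_elts D| <= w)%N) (cardB : (#|min_elts U| <= w)%N)
    (hab : forall a b : P, a \in max_elts D -> b \in min_elts U ->
       eps <= linext_prob R (P := P)
                (fun L => precedes L a x && precedes L x b)) :
  eps ^+ (w ^ 2) <=
    linext_prob R (P := P)
      (fun L => [forall a in max_elts D, precedes L a x] &&
                [forall b in min_elts U, precedes L x b]).
Proof.
have A0 := max_elts_neq0 D_neq0; have B0 := min_elts_neq0 U_neq0.
have [a0 a0A] := set0Pn _ A0; have [b0 b0B] := set0Pn _ B0.
(* Needed because the exponent obtained, [#|A| * #|B|], may be smaller than [w ^ 2]. *)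
have eps_le1 : eps <= 1.
  by apply: le_trans (hab _ _ a0A b0B) _; rewrite -between_prob1 between_prob_le1.
have eps0 := ltW eps_gt0.
change (eps ^+ (w ^ 2) <= between_prob R x (max_elts D) (min_elts U)).
apply: (@le_trans _ _ ((eps ^+ #|min_elts U|) ^+ #|max_elts D|)).
  by rewrite -exprM ler_wiXn2l // expnS expn1 leq_mul.
(* The outer use splits [A], with base [eps ^+ #|B|]; for each [a] in [A] the inner use splits [B],
   with base [eps]. *)
apply: (expr_card_le_supermultiplicative (p := between_prob R x ^~ _)) => //.
- exact: exprn_ge0.
- move=> a aA; apply: expr_card_le_supermultiplicative => // [b bB|T1 T2].
    by rewrite between_prob1 hab.
  exact: between_prob_above.
- by move=> S1 S2; apply: between_prob_below.
Qed.
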